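(* Let $(g,m_0,m_1)$ be one of the following triples: $$(1,m_0,m_0),\ (2,m_0,m_1),\ (3,1,1),\ (3,2,2),\ (3,4,4),\ (3,8,8),\ (4,m_0,1),\ (4,2,2),\ (6,1,1),\ (6,2,2),$$ where $m_0,m_1$ are positive integers, with $m_0\le m_1$ in the case $(2,m_0,m_1)$. Then the identity map of $\mathrm{SO}(n+2)$ is equivariantly stable, where $n=\frac{g(m_0+m_1)}{2}$.
   Context: Setting: an isometric cohomogeneity one action $G\times\mathbb{S}^{n+1}\to\mathbb{S}^{n+1}$ of a compact Lie group $G$ on the round sphere has data $(g,m_0,m_1)$, where $g$ is the number of distinct principal curvatures of the principal orbits, with multiplicities $m_i=m_0$ for $i$ even and $m_i=m_1$ for $i$ odd, so $n=\frac{g(m_0+m_1)}{2}$. Such an action lifts to an isometric cohomogeneity one action of $G\times\mathrm{SO}(n+1)$ on $\mathrm{SO}(n+2)$ (with a biinvariant metric), via the fibration $\mathrm{SO}(n+2)\to\mathbb{S}^{n+1}=\mathrm{SO}(n+2)/\mathrm{SO}(n+1)$. Equivariance is with respect to this lifted action, and $\gamma$ denotes a normal geodesic parametrized (after rescaling) so that the orbit space is $[0,\frac{\pi}{2g}]$. Equivariant self-maps are the maps $a\cdot\gamma(t)\mapsto a\cdot\gamma(r(t))$ with $r(0)=0$, $r(\frac{\pi}{2g})=k\frac{\pi}{2g}$, $k\in\mathbb{Z}$; the identity map is $r(t)=t$. Equivariant variations of $r$ are given by smooth functions $\xi$ on $[0,\frac{\pi}{2g}]$ vanishing at both endpoints.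 The Jacobi equation describing the equivariant stability of the harmonic map given by $r$ is $$\ddot\xi+\big(m_0-m_1+(m_0+m_1)\cos(2gt)\big)\tfrac{g}{\sin(2gt)}\dot\xi-V_r(t)\,\xi+\lambda\xi=0,$$ $$V_r(t)=\tfrac{g}{\sin^2(2gt)}\Big[(2g-2)\cos(2(r(t)-t))\big(m_0+m_1+(m_0-m_1)\cos(2gt)\big)+2\cos(2(r(t)-t)+2gt)\big(m_0-m_1+(m_0+m_1)\cos(2gt)\big)\Big].$$ Up to a positive constant factor, the second variation of the energy in direction $\xi$ is $$\delta^2E(r)(\xi,\xi)=\int_0^{\pi/(2g)}\big(\dot\xi(t)^2+V_r(t)\xi(t)^2\big)\sin^{m_0}(gt)\cos^{m_1}(gt)\,dt.$$ The harmonic map is called equivariantly stable if $\delta^2E(r)(\xi,\xi)>0$ for all such $\xi\not\equiv0$; equivalently, all eigenvalues $\lambda$ of the Jacobi eigenvalue problem are positive. *)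

(* Defs.v *)
From Stdlib Require Import Reals.
From Coquelicot Require Import Coquelicot.
Open Scope R_scope.

(** One-sided derivatives at the endpoints: [D_in] differentiates within the
    closed interval, so [f] is smooth up to the boundary and its values outside
    [a, b] play no role. *)
Definition smooth_on (a b : R) (f : R -> R) : Prop :=
  exists d : nat -> R -> R,
    (forall t, a <= t <= b -> d 0%nat t = f t) /\
    (forall (k : nat) (t : R), a <= t <= b ->
       D_in (d k) (d (S k)) (fun s => a <= s <= b) t).

(** Right end of the orbit space [0, pi/(2g)]. *)
Definition orbit_end (g : nat) : R := PI / (2 * INR g).

(** The potential V_r of the Jacobi equation of the equivariant map
    a.gamma(t) |-> a.gamma(r(t)). *)
Definition jacobi_potential (g m0 m1 : R) (r : R -> R) (t : R) : R :=
  g / (sin (2 * g * t)) ^ 2 *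
  ((2 * g - 2) * cos (2 * (r t - t)) * (m0 + m1 + (m0 - m1) * cos (2 * g * t))
   + 2 * cos (2 * (r t - t) + 2 * g * t)
       * (m0 - m1 + (m0 + m1) * cos (2 * g * t))).

(** Second variation of the energy in direction xi, up to a positive constant.
    [Derive xi] is the derivative of xi in the interior of the interval; at the
    two endpoints the integrand takes conventional values (there
    sin (2 g t) = 0), which do not affect the integral.  For xi smooth on the
    closed interval and zero at its ends, xi^2 compensates the double poles of
    the potential, so the integral is a proper Riemann integral. *)
Definition second_variation (g m0 m1 : nat) (r xi : R -> R) : R :=
  RInt (fun t =>
          ((Derive xi t) ^ 2
           + jacobi_potential (INR g) (INR m0) (INR m1) r t * (xi t) ^ 2)
          * ((sin (INR g * t)) ^ m0 * (cos (INR g * t)) ^ m1))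
       0 (orbit_end g).

Definition equivariant_variation (g : nat) (xi : R -> R) : Prop :=
  smooth_on 0 (orbit_end g) xi /\ xi 0 = 0 /\ xi (orbit_end g) = 0.

(** Stability of the equivariant self-map a.gamma(t) |-> a.gamma(r(t)) of
    SO(n+2), n = g (m0 + m1) / 2, for the lift of a cohomogeneity one action on
    the sphere with data (g, m0, m1). *)
Definition equivariantly_stable (g m0 m1 : nat) (r : R -> R) : Prop :=
  forall xi : R -> R,
    equivariant_variation g xi ->
    (exists t, 0 <= t <= orbit_end g /\ xi t <> 0) ->
    0 < second_variation g m0 m1 r xi.

(** The function r of the identity map. *)
Definition identity_profile : R -> R := fun t => t.

(* Main.v *)
Require Import Defs.
From Stdlib Require Import Reals Lra Lia.
From Coquelicot Require Import Coquelicot.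
Open Scope R_scope.

(** With [w = sin^m0(gt) cos^m1(gt)] and [h = phi'/phi] for
    [phi = sin(gt) cos(gt)], a direct computation gives
    [V - h' - h^2 - h w'/w = kappa], where
    [kappa = g ((2g-2)(m0+m1) + 4g) > 0]: the function [phi] is a positive
    eigenfunction of the Jacobi problem with eigenvalue [kappa]. Hence
    [(xi'^2 + V xi^2) w = (h w xi^2)' + (xi' - h xi)^2 w + kappa xi^2 w],
    and [h w xi^2] vanishes at both ends since [m0, m1 >= 1].
    Writing [xi = sin(2gt) u] with [u] continuous removes all the poles. *)

(** * Extension of functions from a closed interval to the line *)

Definition clamp (a b t : R) : R := Rmax a (Rmin b t).

Lemma clamp_bounds (a b t : R) : a <= b -> a <= clamp a b t <= b.
Proof.
  intros H; unfold clamp, Rmax, Rmin.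
  destruct (Rle_dec b t); destruct Rle_dec; lra.
Qed.

Lemma clamp_id (a b t : R) : a <= t <= b -> clamp a b t = t.
Proof.
  intros H; unfold clamp, Rmax, Rmin.
  destruct (Rle_dec b t); destruct Rle_dec; lra.
Qed.

Lemma clamp_contract (a b s t : R) :
  a <= b -> Rabs (clamp a b s - clamp a b t) <= Rabs (s - t).
Proof.
  intros H; unfold clamp, Rmax, Rmin.
  destruct (Rle_dec b t); destruct (Rle_dec b s);
    repeat destruct Rle_dec; unfold Rabs; repeat destruct Rcase_abs; lra.
Qed.

(** [clamp] is a 1-Lipschitz retraction onto [a, b]. Composing with it makes relative continuity
    global without changing the values on the interval. *)
Lemma continuous_clamp (a b : R) (f : R -> R) :
  a <= b ->
  (forall t, a <= t <= b -> continue_in f (fun s => a <= s <= b) t) ->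
  forall t, continuous (fun s => f (clamp a b s)) t.
Proof.
  intros Hab Hf t.
  apply continuity_pt_filterlim.
  intros eps Heps.
  destruct (Hf (clamp a b t) (clamp_bounds a b t Hab) eps Heps)
    as [delta [Hd Hlim]].
  exists delta; split; [exact Hd|].
  intros s [_ Hs].
  (* [continue_in] is a punctured limit, and [clamp] may identify [s] with [t], so the coincident
     case is separate. *)
  destruct (Req_dec (clamp a b s) (clamp a b t)) as [E|E].
  - rewrite E. simpl. rewrite Rdist_eq. exact Heps.
  - apply Hlim. split.
    + split; [apply clamp_bounds; exact Hab | auto].
    + simpl in *. unfold Rdist in *.
      pose proof (clamp_contract a b s t Hab). lra.
Qed.

(** * Derivatives relative to a set, and strict monotonicity *)

(** L'Hopital at a common zero: [f / h] is there the quotient of the two difference quotients.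
    Working relative to [D] covers one-sided limits. *)
Lemma D_in_quotient_limit (f h df dh : R -> R) (D : R -> Prop) (x : R) :
  D_in f df D x -> D_in h dh D x -> f x = 0 -> h x = 0 -> dh x <> 0 ->
  limit1_in (fun t => f t / h t) (D_x D x) (df x / dh x) x.
Proof.
  intros Hf Hh f0 h0 Hne.
  pose proof (limit_mul _ _ _ _ _ _ Hf (limit_inv _ _ _ _ Hh Hne)) as H.
  intros eps Heps.
  destruct (H eps Heps) as [delta [Hd Hlim]].
  exists delta; split; [exact Hd|].
  intros t Ht.
  replace (f t / h t)
    with ((f t - f x) / (t - x) * / ((h t - h x) / (t - x))).
  - exact (Hlim t Ht).
  - destruct Ht as [[_ Htx] _].
    rewrite f0, h0, !Rminus_0_r.
    (* With [/ 0 = 0] these rewrites are valid even where [h t = 0]. *)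
    unfold Rdiv; rewrite Rinv_mult, Rinv_inv.
    replace (f t * / (t - x) * (/ h t * (t - x)))
      with (f t * / h t * (/ (t - x) * (t - x))) by ring.
    rewrite Rinv_l by lra. ring.
Qed.

Lemma D_in_is_derive (a b : R) (f df : R -> R) (t : R) :
  a < t < b -> D_in f df (fun s => a <= s <= b) t -> is_derive f t (df t).
Proof.
  intros Ht H.
  apply is_derive_Reals.
  intros eps Heps.
  destruct (H eps Heps) as [delta [Hd Hlim]].
  assert (Hm : 0 < Rmin delta (Rmin (t - a) (b - t)))
    by (repeat apply Rmin_pos; lra).
  exists (mkposreal _ Hm).
  intros k Hk Hkd; simpl in Hkd.
  pose proof (Rmin_l delta (Rmin (t - a) (b - t))).
  pose proof (Rmin_r delta (Rmin (t - a) (b - t))).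
  pose proof (Rmin_l (t - a) (b - t)).
  pose proof (Rmin_r (t - a) (b - t)).
  assert (Hb : - (Rmin (t - a) (b - t)) < k < Rmin (t - a) (b - t))
    by (apply Rabs_lt_between; lra).
  specialize (Hlim (t + k)). simpl in Hlim. unfold Rdist in Hlim.
  replace (t + k - t) with k in Hlim by ring.
  apply Hlim. split; [split|]; lra.
Qed.

(** The mean value theorem makes [f] nondecreasing; if [f b <= f a], then [f] is constant and its
    derivative at [c] is zero, a contradiction. *)
Lemma derive_pos_increasing (a b c : R) (f df : R -> R) :
  a < c < b ->
  (forall t, a < t < b -> is_derive f t (df t)) ->
  (forall t, a <= t <= b -> continuity_pt f t) ->
  (forall t, a <= t <= b -> 0 <= df t) ->
  0 < df c -> f a < f b.
Proof.
  intros Hc Hder Hcont Hpos Hdc.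
  assert (Hmono : forall x y, a <= x <= y -> y <= b -> f x <= f y).
  { intros x y Hx Hy.
    destruct (MVT_gen f x y df) as [z [Hz E]];
      rewrite ?Rmin_left, ?Rmax_right in * by lra.
    - intros z Hz; apply Hder; lra.
    - intros z Hz; apply Hcont; lra.
    - assert (0 <= df z * (y - x))
        by (apply Rmult_le_pos; [apply Hpos|]; lra).
      lra. }
  destruct (Rlt_or_le (f a) (f b)) as [|Hle]; [assumption|exfalso].
  assert (Hconst : forall t, a <= t <= b -> f t = f a).
  { intros t Ht.
    assert (f a <= f t) by (apply Hmono; lra).
    assert (f t <= f b) by (apply Hmono; lra).
    lra. }
  assert (Hz : is_derive f c 0).
  { apply is_derive_ext_loc with (fun _ => f a).
    - apply (locally_interval _ c a b); simpl; try lra.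
      intros y Hy1 Hy2. symmetry. apply Hconst. simpl in *; lra.
    - apply (is_derive_const (f a) c). }
  pose proof (is_derive_unique _ _ _ Hz).
  pose proof (is_derive_unique _ _ _ (Hder c Hc)).
  lra.
Qed.

(** * Dividing a variation by sin(2gt) *)

(** [xi] is arbitrary outside the interval, so it and its derivative are replaced by the continuous
    extensions [x] and [y]. The simple zeros of the sine at both ends are absorbed by those of [xi],
    which makes [u] continuous. *)
Lemma smooth_on_sin_factor (g : nat) (xi : R -> R) :
  (0 < g)%nat -> equivariant_variation g xi ->
  exists x y u : R -> R,
    (forall t, continuous x t) /\ (forall t, continuous y t) /\
    (forall t, continuous u t) /\
    (forall t, 0 <= t <= orbit_end g -> x t = xi t) /\
    (forall t, 0 < t < orbit_end g ->
       is_derive x t (y t) /\ Derive xi t = y t /\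
       x t = sin (2 * INR g * t) * u t).
Proof.
  intros Hg [[d [Hd0 HD]] [xi0 xib]].
  set (b := orbit_end g) in *.
  assert (HG : 0 < INR g) by (apply lt_0_INR; exact Hg).
  assert (Hb : 0 < b).
  { unfold b, orbit_end. apply Rdiv_lt_0_compat; [exact PI_RGT_0|lra]. }
  assert (Hbpi : 2 * INR g * b = PI) by (unfold b, orbit_end; field; lra).
  set (I := fun s => 0 <= s <= b) in *.
  set (sn := fun t => sin (2 * INR g * t)).
  set (cs := fun t => 2 * INR g * cos (2 * INR g * t)).
  assert (Hsn : forall t, is_derive sn t (cs t)).
  { intros t; unfold sn, cs; auto_derive; [trivial|ring]. }
  assert (HsnD : forall t, D_in sn cs I t).
  { intros t. apply (D_in_imp _ _ no_cond); [red; trivial|].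
    apply derivable_pt_lim_D_in, is_derive_Reals, Hsn. }
  assert (Hsn0 : sn 0 = 0) by (unfold sn; rewrite Rmult_0_r; apply sin_0).
  assert (Hsnb : sn b = 0) by (unfold sn; rewrite Hbpi; apply sin_PI).
  assert (Hcs0 : cs 0 = 2 * INR g)
    by (unfold cs; rewrite Rmult_0_r, cos_0; ring).
  assert (Hcsb : cs b = - (2 * INR g))
    by (unfold cs; rewrite Hbpi, cos_PI; ring).
  assert (Hsnpos : forall t, 0 < t < b -> 0 < sn t).
  { intros t Ht; apply sin_gt_0.
    - apply Rmult_lt_0_compat; lra.
    - rewrite <- Hbpi; apply Rmult_lt_compat_l; lra. }
  (* On [I] the zeros of [sn] are the two endpoints; the value chosen there is the limit from
     [D_in_quotient_limit]. *)
  set (v := fun t =>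
    if Req_EM_T (sn t) 0 then d 1%nat t / cs t else d 0%nat t / sn t).
  assert (Hdc : forall k t, I t -> continue_in (d k) I t).
  { intros k t Ht. apply (cont_deriv _ (d (S k))), HD, Ht. }
  assert (Hv : forall t, I t -> continue_in v I t).
  { intros t Ht.
    destruct (Req_EM_T (sn t) 0) as [E|E].
    - assert (Hend : t = 0 \/ t = b).
      { destruct (Rle_lt_or_eq_dec 0 t (proj1 Ht)); [|auto].
        destruct (Rle_lt_or_eq_dec t b (proj2 Ht)); [|auto].
        specialize (Hsnpos t); lra. }
      assert (Hf : d 0%nat t = 0)
        by (rewrite Hd0 by exact Ht; destruct Hend; subst t; assumption).
      assert (Hc : cs t <> 0) by (destruct Hend; subst t; lra).
      pose proof (D_in_quotient_limit _ _ _ _ I t (HD 0%nat t Ht) (HsnD t)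
                    Hf E Hc) as Hq.
      assert (Hvt : v t = d 1%nat t / cs t)
        by (unfold v; destruct Req_EM_T; [reflexivity|contradiction]).
      unfold continue_in. rewrite Hvt.
      (* The other zero of [sn] is at distance [b] from [t]. *)
      intros eps Heps. destruct (Hq eps Heps) as [delta [Hdelta Hlim]].
      exists (Rmin delta b); split; [apply Rmin_pos; assumption|].
      intros s [[Hs Hne] Hdist]; simpl in Hdist; unfold Rdist in Hdist.
      pose proof (Rmin_l delta b). pose proof (Rmin_r delta b).
      assert (Hst : - b < s - t < b) by (apply Rabs_lt_between; lra).
      assert (0 < sn s).
      { apply Hsnpos. unfold I in Hs. destruct Hend; subst t; lra. }
      unfold v. destruct Req_EM_T; [lra|].
      apply Hlim. split; [split; assumption|]. simpl; unfold Rdist; lra.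
    - assert (Hint : 0 < t < b).
      { unfold I in Ht.
        destruct (Req_dec t 0); [subst t; contradiction|].
        destruct (Req_dec t b); [subst t; contradiction|]. lra. }
      assert (Hq : continue_in (fun s => d 0%nat s / sn s) I t).
      { apply limit_mul; [apply Hdc, Ht|].
        apply limit_inv; [|exact E].
        apply (cont_deriv _ cs), HsnD. }
      unfold continue_in.
      replace (v t) with (d 0%nat t / sn t)
        by (unfold v; destruct Req_EM_T; [contradiction|reflexivity]).
      intros eps Heps. destruct (Hq eps Heps) as [delta [Hdelta Hlim]].
      (* This radius keeps [s] strictly between the endpoints, where [v] is the plain quotient. *)
      exists (Rmin delta (Rmin t (b - t))).
      split; [repeat apply Rmin_pos; lra|].
      intros s [[Hs Hne] Hdist]; simpl in Hdist; unfold Rdist in Hdist.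
      pose proof (Rmin_l delta (Rmin t (b - t))).
      pose proof (Rmin_r delta (Rmin t (b - t))).
      pose proof (Rmin_l t (b - t)). pose proof (Rmin_r t (b - t)).
      assert (Hst : - Rmin t (b - t) < s - t < Rmin t (b - t))
        by (apply Rabs_lt_between; lra).
      assert (0 < sn s) by (apply Hsnpos; lra).
      unfold v. destruct Req_EM_T; [lra|].
      apply Hlim. split; [split; assumption|]. simpl; unfold Rdist; lra. }
  assert (Hloc : forall t (f f' : R -> R), 0 < t < b ->
            (forall s, I s -> f s = f' s) -> locally t (fun s => f s = f' s)).
  { intros t f f' Ht Hff.
    apply (locally_interval _ t 0 b); simpl; try lra.
    intros s Hs1 Hs2; simpl in *. apply Hff; unfold I; lra. }
  assert (Hder : forall t, 0 < t < b -> is_derive (d 0%nat) t (d 1%nat t)).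
  { intros t Ht. apply (D_in_is_derive 0 b); [exact Ht|].
    apply HD; unfold I; lra. }
  exists (fun t => d 0%nat (clamp 0 b t)), (fun t => d 1%nat (clamp 0 b t)),
    (fun t => v (clamp 0 b t)).
  refine (conj _ (conj _ (conj _ (conj _ (fun t Ht => conj _ (conj _ _)))))).
  - apply (continuous_clamp 0 b (d 0%nat)); [lra|]. intros; apply Hdc; assumption.
  - apply (continuous_clamp 0 b (d 1%nat)); [lra|]. intros; apply Hdc; assumption.
  - apply (continuous_clamp 0 b v); [lra|]. intros; apply Hv; assumption.
  - intros t Ht. rewrite clamp_id by exact Ht. apply Hd0, Ht.
  - rewrite (clamp_id 0 b t) by lra.
    apply (is_derive_ext_loc (d 0%nat)); [|apply Hder; assumption].
    apply Hloc; [assumption|]. intros s Hs; rewrite clamp_id; trivial.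
  - rewrite clamp_id by lra. apply is_derive_unique.
    apply (is_derive_ext_loc (d 0%nat)); [|apply Hder; assumption].
    apply Hloc; assumption.
  - rewrite clamp_id by lra. specialize (Hsnpos t Ht). fold (sn t).
    unfold v. destruct Req_EM_T; [lra|]. field. assumption.
Qed.

(** * The integral identity and positivity *)

(** The logarithmic form keeps the exponent [n] instead of [pred n], so the derivative of [W] below
    is a multiple of [W]. *)
Lemma is_derive_pow_log (f : R -> R) (l x : R) (n : nat) :
  is_derive f x l -> f x <> 0 ->
  is_derive (fun t => f t ^ n) x (INR n * (l / f x) * f x ^ n).
Proof.
  intros Hf Hne.
  evar_last; [exact (is_derive_pow f n x l Hf)|].
  destruct n; [simpl; ring|]. simpl pred. rewrite <- tech_pow_Rmult.
  field. exact Hne.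
Qed.

Theorem identity_equivariantly_stable (g m0 m1 : nat) :
  (0 < g)%nat -> (0 < m0)%nat -> (0 < m1)%nat ->
  equivariantly_stable g m0 m1 identity_profile.
Proof.
  intros Hg Hm0 Hm1 xi Hxi [t0 [Ht0 Hne]].
  destruct (smooth_on_sin_factor g xi Hg Hxi)
    as [x [y [u [Cx [Cy [Cu [Hx Hint]]]]]]].
  destruct Hxi as [_ [xi0 xib]].
  destruct m0 as [|p]; [lia|]. destruct m1 as [|q]; [lia|].
  clear Hm0 Hm1.
  unfold second_variation.
  set (b := orbit_end g) in *.
  assert (HG1 : 1 <= INR g) by (apply (le_INR 1); lia).
  set (G := INR g) in *.
  assert (Hbpi : G * b = PI / 2) by (unfold b, orbit_end; fold G; field; lra).
  assert (Hb : 0 < b).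
  { unfold b, orbit_end. apply Rdiv_lt_0_compat; [exact PI_RGT_0|].
    fold G; lra. }
  set (M := INR (S p) + INR (S q)). set (D := INR (S p) - INR (S q)).
  set (w := fun t => sin (G * t) ^ S p * cos (G * t) ^ S q).
  (* The integrand after substituting xi = sin(2gt) u, with the double pole cancelled. It equals the
     original one on the open interval, which is all that [RInt_ext] asks. *)
  set (J := fun t =>
    (y t ^ 2 + G * u t ^ 2 *
       ((2 * G - 2) * (M + D * cos (2 * G * t))
        + 2 * cos (2 * G * t) * (D + M * cos (2 * G * t)))) * w t).
  assert (HcJ : forall t, continuous J t).
  { intros t. unfold J, w.
    assert (Hc : forall f : R -> R, (forall s, ex_derive f s) -> continuous f t)
      by (intros f Hf; apply (ex_derive_continuous f), Hf).
    apply (continuous_mult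
             (fun t => y t ^ 2 + G * u t ^ 2 *
                ((2 * G - 2) * (M + D * cos (2 * G * t))
                 + 2 * cos (2 * G * t) * (D + M * cos (2 * G * t)))) w).
    - apply (continuous_plus (fun t => y t ^ 2)).
      + apply (continuous_comp y (fun z => z ^ 2)); [apply Cy|].
        apply (ex_derive_continuous (fun z => z ^ 2)). auto_derive; trivial.
      + apply (continuous_mult (fun t => G * u t ^ 2)).
        * apply (continuous_comp u (fun z => G * z ^ 2)); [apply Cu|].
          apply (ex_derive_continuous (fun z => G * z ^ 2)).
          auto_derive; trivial.
        * apply Hc. intros s; auto_derive; trivial.
    - apply Hc. intros s; unfold w; auto_derive; trivial. }
  assert (Hsc : forall t, 0 < t < b -> 0 < sin (G * t) /\ 0 < cos (G * t)).
  { intros t Ht.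
    assert (0 < G * t) by (apply Rmult_lt_0_compat; lra).
    assert (G * t < PI / 2)
      by (rewrite <- Hbpi; apply Rmult_lt_compat_l; lra).
    split; [apply sin_gt_0|apply cos_gt_0]; lra. }
  assert (Hdouble : forall t, sin (2 * G * t) = 2 * sin (G * t) * cos (G * t)
            /\ cos (2 * G * t) = cos (G * t) ^ 2 - sin (G * t) ^ 2).
  { intros t. replace (2 * G * t) with (2 * (G * t)) by ring.
    split; [apply sin_2a|rewrite cos_2a; ring]. }
  rewrite (RInt_ext _ J); cycle 1.
  { intros t Ht. rewrite Rmin_left, Rmax_right in Ht by lra.
    destruct (Hint t Ht) as [_ [Hdxi Hxu]].
    rewrite Hdxi, <- Hx, Hxu by lra.
    unfold J, jacobi_potential, identity_profile, w. fold M D.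
    rewrite Rminus_diag, Rmult_0_r, cos_0, Rplus_0_l.
    assert (sin (2 * G * t) <> 0).
    { destruct (Hsc t Ht) as [Hs Hc]. rewrite (proj1 (Hdouble t)).
      pose proof (Rmult_lt_0_compat _ _ Hs Hc). lra. }
    f_equal. f_equal. field. assumption. }
  set (W := fun t => sin (G * t) ^ p * cos (G * t) ^ q).
  (* [A] is h w without a pole: the denominator sin(gt) cos(gt) of h cancels one factor of each kind
     in w, leaving [W] with exponents [p] and [q]. *)
  set (A := fun t => G * W t * (cos (G * t) ^ 2 - sin (G * t) ^ 2)).
  set (kappa := G * ((2 * G - 2) * M + 4 * G)).
  assert (Hkappa : 0 < kappa).
  { apply Rmult_lt_0_compat; [lra|].
    assert (0 <= M) by (apply Rplus_le_le_0_compat; apply pos_INR).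
    assert (0 <= (2 * G - 2) * M) by (apply Rmult_le_pos; lra). lra. }
  (* Here h xi has become [2 * G * u t * cos (2 * G * t)], since sin(2gt) = 2 sin(gt) cos(gt). *)
  set (E := fun t =>
    ((y t - 2 * G * u t * cos (2 * G * t)) ^ 2 + kappa * x t ^ 2) * w t).
  set (P := fun t => RInt J 0 t).
  set (N := fun t => P t - A t * x t ^ 2).
  assert (HdJ : forall t, is_derive P t (J t)).
  { intros t. apply (is_derive_RInt J _ 0 t); [|apply HcJ].
    exists (mkposreal 1 Rlt_0_1). intros s _.
    apply (RInt_correct (V := R_CompleteNormedModule)).
    apply (ex_RInt_continuous (V := R_CompleteNormedModule)).
    intros; apply HcJ. }
  assert (Hx0 : x 0 = 0) by (rewrite Hx by lra; exact xi0).
  assert (Hxb : x b = 0) by (rewrite Hx by lra; exact xib).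
  assert (Ht0i : 0 < t0 < b).
  { destruct (Req_dec t0 0); [subst; contradiction|].
    destruct (Req_dec t0 b); [subst; contradiction|]. lra. }
  (* The boundary terms [A t * x t ^ 2] vanish at both ends, so [N b - N 0] is the whole
     integral. *)
  enough (HN : N 0 < N b).
  { change (0 < RInt J 0 b). unfold N, P in HN.
    rewrite Hx0, Hxb, RInt_point in HN.
    unfold zero in HN; simpl in HN. lra. }
  apply (derive_pos_increasing 0 b t0 N E Ht0i).
  - intros t Ht. destruct (Hint t Ht) as [Hdx [_ Hxu]].
    destruct (Hsc t Ht) as [Hs Hc]. destruct (Hdouble t) as [Hs2 Hc2].
    pose proof (sin2_cos2 (G * t)) as Hpy; unfold Rsqr in Hpy.
    assert (HW : is_derive W t
      ((INR p * (G * cos (G * t) / sin (G * t))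
        - INR q * (G * sin (G * t) / cos (G * t))) * W t)).
    { unfold W. evar_last.
      - apply (is_derive_mult (fun s => sin (G * s) ^ p)
                 (fun s => cos (G * s) ^ q)).
        + apply (is_derive_pow_log (fun s => sin (G * s))
                   (G * cos (G * t))); [auto_derive; [trivial|ring]|lra].
        + apply (is_derive_pow_log (fun s => cos (G * s))
                   (- (G * sin (G * t)))); [auto_derive; [trivial|ring]|lra].
        + intros; apply Rmult_comm.
      - unfold plus, mult; simpl. field. lra. }
    unfold N, A.
    auto_derive.
    + repeat split; [eexists; apply HdJ|eexists; exact HW|eexists; exact Hdx].
    + replace (Derive (fun s => P s) t) with (J t)
        by (symmetry; apply is_derive_unique, HdJ).
      replace (Derive (fun s => W s) t) with
        ((INR p * (G * cos (G * t) / sin (G * t))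
        - INR q * (G * sin (G * t) / cos (G * t))) * W t)
        by (symmetry; apply is_derive_unique; exact HW).
      replace (Derive (fun s => x s) t) with (y t)
        by (symmetry; apply is_derive_unique; exact Hdx).
      unfold J, E, kappa.
      replace (w t) with (W t * (sin (G * t) * cos (G * t)))
        by (unfold w, W; simpl; ring).
      rewrite Hxu, Hs2, Hc2. unfold M, D. rewrite !S_INR.
      (* Once [k] and [s] are free variables, the claim [N' = E] is a rational identity modulo
         [k * k = 1 - s * s]. *)
      generalize dependent (cos (G * t)). intros k.
      generalize dependent (sin (G * t)). intros s.
      intros. clear - Hs Hc Hpy.
      assert (Hk : k * k = 1 - s * s) by lra.
      field_simplify_eq; [|lra].
      ring [Hk].
  (* The clamped [x] may have a corner at an endpoint, so continuity of [N] comes from that of its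
     factors. *)
  - intros t _. apply continuity_pt_filterlim.
    unfold N. apply (continuous_minus P (fun s => A s * x s ^ 2)).
    + apply (ex_derive_continuous P).
      eexists; apply HdJ.
    + apply (continuous_mult A (fun s => x s ^ 2)).
      * apply (ex_derive_continuous A). unfold A, W. auto_derive; trivial.
      * apply (continuous_comp x (fun z => z ^ 2)); [apply Cx|].
        apply (ex_derive_continuous (fun z => z ^ 2)). auto_derive; trivial.
  - intros t Ht. unfold E, w.
    assert (0 <= G * t <= PI / 2).
    { rewrite <- Hbpi. split; [apply Rmult_le_pos|apply Rmult_le_compat_l]; lra. }
    apply Rmult_le_pos.
    + apply Rplus_le_le_0_compat; [apply pow2_ge_0|].
      apply Rmult_le_pos; [lra|apply pow2_ge_0].
    + apply Rmult_le_pos; apply pow_le;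
        [apply sin_ge_0|apply cos_ge_0]; lra.
  (* Strictness comes from the [kappa] term: [x t0 = xi t0] is nonzero and the weight is positive at
     the interior point [t0]. *)
  - unfold E, w. destruct (Hsc t0 Ht0i) as [Hs Hc].
    apply Rmult_lt_0_compat.
    + apply Rplus_le_lt_0_compat; [apply pow2_ge_0|].
      apply Rmult_lt_0_compat; [lra|]. apply pow2_gt_0.
      rewrite Hx by exact Ht0. exact Hne.
    + apply Rmult_lt_0_compat; apply pow_lt; assumption.
Qed.

Theorem theorem4p8 (g m0 m1 : nat)
  (hm0 : (0 < m0)%nat) (hm1 : (0 < m1)%nat)
  (hlist :
     (g = 1%nat /\ m0 = m1) \/
     (g = 2%nat /\ (m0 <= m1)%nat) \/
     (g = 3%nat /\ m0 = 1%nat /\ m1 = 1%nat) \/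
     (g = 3%nat /\ m0 = 2%nat /\ m1 = 2%nat) \/
     (g = 3%nat /\ m0 = 4%nat /\ m1 = 4%nat) \/
     (g = 3%nat /\ m0 = 8%nat /\ m1 = 8%nat) \/
     (g = 4%nat /\ m1 = 1%nat) \/
     (g = 4%nat /\ m0 = 2%nat /\ m1 = 2%nat) \/
     (g = 6%nat /\ m0 = 1%nat /\ m1 = 1%nat) \/
     (g = 6%nat /\ m0 = 2%nat /\ m1 = 2%nat)) :
  equivariantly_stable g m0 m1 identity_profile.
Proof.
  (* Each case of [hlist] fixes a positive [g]. *)
  apply identity_equivariantly_stable; lia.
Qed.
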